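(* Let $k$ be a positive integer, $n$ a non-negative integer, $i\in\{3,5,7\}$, and let $p$ be a prime with $p\equiv i\pmod 8$. Let $\delta$ be a non-negative integer with $p\mid 8\delta+i$. Put $$N_1=3p\,(8p^kn+8\delta+i),\qquad N_2=24\Big(p^{k-1}n+\frac{8\delta+i-p}{8p}\Big)+3.$$ Then $\mathcal{J}_6(N_1)\equiv\mathcal{J}_6(N_2)\pmod 2$.
   Context: Let $q=e^{2\pi i\tau}$, $(a;q)_\infty=\prod_{j\ge0}(1-aq^j)$, and $\eta(\tau)=q^{1/24}(q;q)_\infty$. Define $$j_6(\tau)=\left(\frac{\eta(2\tau)\eta(3\tau)^3}{\eta(\tau)\eta(6\tau)^3}\right)^3-3=\frac1q+\sum_{n\ge0}\mathcal{J}_6(n)q^n.$$ *)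

(* Defs.v *)
From mathcomp Require Import all_boot all_order all_algebra.
Set Implicit Arguments. Unset Strict Implicit. Unset Printing Implicit Defensive.
Import Order.TTheory GRing.Theory Num.Theory.
Local Open Scope ring_scope.

(* Truncation of (q^a; q^a)_oo = prod_{j>=1} (1 - q^(a j)) to the factors j <= M.
   For a >= 1 the omitted factors only affect coefficients of degree > M. *)
Definition qpoch_trunc (a M : nat) : {poly int} :=
  \prod_(1 <= j < M.+1) (1 - 'X^(a * j)).

(* Truncation of 1/(q^a; q^a)_oo = prod_{j>=1} sum_{k>=0} q^(a j k):
   factors j <= M and geometric terms k <= M; exact in degrees <= M for a >= 1. *)
Definition qpoch_inv_trunc (a M : nat) : {poly int} :=
  \prod_(1 <= j < M.+1) \sum_(0 <= k < M.+1) 'X^(a * j * k).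

(* Truncation of F(q) = ((q^2;q^2)(q^3;q^3)^3 / ((q;q)(q^6;q^6)^3))^3,
   exact in degrees <= M, so that j_6(tau) = F(q)/q - 3. *)
Definition F6_trunc (M : nat) : {poly int} :=
  (qpoch_trunc 2 M * qpoch_trunc 3 M ^+ 3
   * qpoch_inv_trunc 1 M * qpoch_inv_trunc 6 M ^+ 3) ^+ 3.

Definition F6_coef (m : nat) : int := (F6_trunc m)`_m.

(* j_6(tau) = 1/q + sum_{n>=0} J6 n q^n, i.e. J6 n = [q^(n+1)] F - 3 [n = 0]. *)
Definition J6 (n : nat) : int :=
  F6_coef n.+1 - (if n == 0%N then 3 else 0).

(* Main.v *)
Require Import Defs.
From mathcomp Require Import all_boot all_order all_algebra.
From mathcomp Require Import ring zify.

(** Put psi(q) = sum_s q^(s(s+1)/2).  Modulo 2, Gauss's product for psi gives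
    psi = (q;q)^3, hence
    j_6 + 3 = psi(q) / (q psi(q^3)^3) =: sum_n c(n) q^n.  The exponents of
    psi that are 1 mod 3 form 1 + 9 T_r, so
    sum_m c(3m) q^m = psi(q^3) / psi(q)^3.
    Modulo 2 one also has psi(q) psi(q^3) = psi(q)^4 + q psi(q^3)^4, from an
    involution on the representations x^2 + 3 y^2.  Using it twice,
    psi(q^3) psi^5 = psi^8 + q psi^16 + q^5 psi(q^3)^16, and since eighth powers
    are series in q^8, extracting the exponents 1 mod 8 shows that
    J_6(3(8l+1)) is odd iff l is triangular, i.e. iff 8l+1 is a square.
    Finally N_1 / 3 = p^2 (N_2 / 3), with N_2 / 3 = 1 mod 8. *)

Set Implicit Arguments. Unset Strict Implicit. Unset Printing Implicit Defensive.
Import Order.TTheory GRing.Theory Num.Theory.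
Local Open Scope ring_scope.

(** * Triangular numbers *)

Definition tri (s : nat) : nat := ((s * s.+1) %/ 2)%N.

Lemma triE s : (2 * tri s = s * s.+1)%N.
Proof.
rewrite /tri mulnC divnK // dvdn2 oddM /=; by case: (odd s).
Qed.

Lemma leq_tri s : (s <= tri s)%N.
Proof. by have := triE s; nia. Qed.

Lemma tri_inj : injective tri.
Proof. by move=> a b eqT; have := triE a; have := triE b; rewrite eqT; nia. Qed.

(** * A finite form of Gauss's identity *)

Section Shanks.
Variables (R : comNzRingType) (q : R).

Let Od n : R := \prod_(0 <= j < n) (1 - q ^+ (2 * j).+1).
Let Ev m n : R := \prod_(m <= j < n) (1 - q ^+ (2 * j.+1)).

(* The difference of consecutive instances telescopes; every factor is kept
   polynomial by clearing the denominators of Shanks' finite form of Gauss's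
   identity. *)
Lemma shanks_identity n :
  \sum_(0 <= s < n) Od s * Ev s n * q ^+ (s * (2 * n).+1)
  = Od n * \sum_(0 <= s < 2 * n) q ^+ tri s.
Proof.
elim: n => [|n IHn]; first by rewrite !big_geq // mulr0.
have OdS s : Od s.+1 = Od s * (1 - q ^+ (2 * s).+1) by rewrite /Od big_nat_recr.
have EvS s : (s <= n)%N -> Ev s n.+1 = Ev s n * (1 - q ^+ (2 * n.+1)).
  by move=> le_sn; rewrite /Ev big_nat_recr.
have Evr s : (s < n)%N -> Ev s n = (1 - q ^+ (2 * s.+1)) * Ev s.+1 n.
  by move=> lt_sn; rewrite /Ev big_ltn.
(* Passing from n to n+1 multiplies the s-th term by 1 - q^(2n+1), the factor that turns [Od n] into
   [Od n.+1], up to a difference of [U]; the factor 1 - q^(2s) makes [U 0] vanish. *)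
pose U s := Od s * (1 - q ^+ (2 * s)) * Ev s n * q ^+ (s * (2 * n).+1).
have term s : (s < n)%N -> Od s * Ev s n.+1 * q ^+ (s * (2 * n.+1).+1) =
    (1 - q ^+ (2 * n).+1) * (Od s * Ev s n * q ^+ (s * (2 * n).+1))
    + (U s.+1 - U s).
  move=> lt_sn; rewrite /U OdS (EvS _ (ltnW lt_sn)) (Evr _ lt_sn).
  have -> : (s * (2 * n.+1).+1 = s * (2 * n).+1 + 2 * s)%N by lia.
  have -> : (s.+1 * (2 * n).+1 = s * (2 * n).+1 + (2 * n).+1)%N by lia.
  have -> : (2 * s.+1 = (2 * s).+2)%N by lia.
  have -> : (2 * n.+1 = (2 * n).+2)%N by lia.
  set a := (2 * s)%N; set b := (2 * n)%N; clearbody a b.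
  rewrite !exprD !exprS; ring.
have EvT : Ev n n = 1 by rewrite /Ev big_geq.
rewrite big_nat_recr //= (eq_big_nat _ _ (fun s _ => term s _)); last by [].
rewrite big_split /= -big_distrr /= IHn telescope_sumr // {1}/U EvT.
have -> : U 0%N = 0 by rewrite /U expr0 subrr mulr0 !mul0r.
have -> : (2 * n.+1 = (2 * n).+2)%N by lia.
rewrite 2?big_nat_recr //= OdS EvS // EvT.
have -> : tri (2 * n) = (n * (2 * n).+1)%N by have := triE (2 * n); lia.
have -> : tri (2 * n).+1 = (n * (2 * n).+1 + (2 * n).+1)%N.
  by have := triE (2 * n).+1; lia.
have -> : (n * (2 * n).+3 = n * (2 * n).+1 + 2 * n)%N by lia.
have -> : (2 * n.+1 = (2 * n).+2)%N by lia.
set b := (2 * n)%N; clearbody b; rewrite !exprD !exprS; ring.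
Qed.
End Shanks.

(** * Sums invariant under an involution in characteristic 2 *)

Section InvolutionSum.
Variables (R : pzRingType) (I : finType) (P : pred I) (f : I -> I) (F : I -> R).

(** The points moved by [f] fall into pairs with equal summands, and each pair contributes x + x =
    0. *)
Lemma sum_involution_pchar2 : (forall x : R, x + x = 0) ->
    (forall i, P i -> P (f i)) -> (forall i, P i -> f (f i) = i) ->
    (forall i, P i -> F (f i) = F i) ->
  \sum_(i | P i) F i = \sum_(i | P i && (f i == i)) F i.
Proof.
move=> R2 Pf fK Ff; rewrite (bigID (fun i => f i == i)) /=.
suff -> : \sum_(i | P i && (f i != i)) F i = 0 by rewrite addr0.
(* Comparing ranks selects one point of each pair, and [f] exchanges the two halves. *)
pose below i := (enum_rank i < enum_rank (f i))%N.
rewrite (bigID below) /= (reindex_onto f f) /=; last first.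
  by move=> i /andP[/andP[Pi _] _]; exact: fK.
set A := (X in X + _); set B := (X in _ + X); suff -> : A = B by [].
apply: eq_big => [i|i /andP[/andP[/andP[Pfi _] _] /eqP fi]].
  have [Pi | nPi] := boolP (P i); last first.
    apply/negP => /andP[/andP[/andP[Pfi _] _] /eqP ffi].
    by move: (Pf _ Pfi); rewrite ffi (negPf nPi).
  rewrite Pf // fK // eqxx andbT /= /below fK // eq_sym -leqNgt.
  have [-> | fi_neq] := eqVneq; first by [].
  by rewrite ltn_neqAle (inj_eq val_inj) (inj_eq enum_rank_inj) fi_neq.
by rewrite -[in RHS]fi -(Ff (f i)).
Qed.
End InvolutionSum.

(** * Congruence modulo X^n, standing for truncated power series, and extraction of residue classes
    of exponents *)

Definition eqm (R : nzRingType) (n : nat) (A B : {poly R}) : Prop :=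
  forall i, (i < n)%N -> A`_i = B`_i.

Section TruncatedEquality.
Variable R : comNzRingType.
Implicit Types (A B C D : {poly R}) (d n r : nat).

Lemma eqm_sym n A B : eqm n A B -> eqm n B A.
Proof. by move=> AB i /AB. Qed.

Lemma eqm_trans n A B C : eqm n A B -> eqm n B C -> eqm n A C.
Proof. by move=> AB BC i lt_in; rewrite AB // BC. Qed.

Lemma eqm_leq m n A B : (m <= n)%N -> eqm n A B -> eqm m A B.
Proof. by move=> le_mn AB i lt_im; apply: AB; apply: leq_trans le_mn. Qed.

Lemma eqmD n A B C D : eqm n A B -> eqm n C D -> eqm n (A + C) (B + D).
Proof. by move=> AB CD i lt_in; rewrite !coefD AB // CD. Qed.

Lemma eqmM n A B C D : eqm n A B -> eqm n C D -> eqm n (A * C) (B * D).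
Proof.
move=> AB CD i lt_in; rewrite !coefM; apply: eq_bigr => j _.
by rewrite AB ?CD // (leq_ltn_trans _ lt_in) // ?leq_subr // -ltnS.
Qed.

Lemma eqmMl n A B C : eqm n A B -> eqm n (C * A) (C * B).
Proof. exact: eqmM. Qed.

Lemma eqmMr n A B C : eqm n A B -> eqm n (A * C) (B * C).
Proof. by move=> AB; apply: eqmM. Qed.

Lemma eqmX n k A B : eqm n A B -> eqm n (A ^+ k) (B ^+ k).
Proof.
by move=> AB; elim: k => [|k IHk]; rewrite ?exprS //; apply: eqmM.
Qed.

Lemma eqm_prod1 n (I : Type) (s : seq I) (E : I -> {poly R}) :
  (forall i, eqm n (E i) 1) -> eqm n (\prod_(i <- s) E i) 1.
Proof.
move=> E1; elim: s => [|i s IHs]; first by rewrite big_nil.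
by rewrite big_cons -[X in eqm _ _ X]mulr1; apply: eqmM.
Qed.

Lemma eqm_comp n d A B : (0 < d)%N -> eqm n A B ->
  eqm n (A \Po 'X^d) (B \Po 'X^d).
Proof.
move=> d_gt0 AB i lt_in; rewrite !coef_comp_poly_Xn //; case: ifP => // _.
by apply: AB; apply: leq_ltn_trans (leq_div _ _) lt_in.
Qed.

(** A series with constant term 1 is invertible; here the coefficients are cancelled one by one, by
    strong induction. *)
Lemma eqmM2r n A B C : C`_0 = 1 -> eqm n (A * C) (B * C) -> eqm n A B.
Proof.
move=> C0 AB i; elim/ltn_ind: i => i IHi lt_in.
have := AB i lt_in; rewrite !coefM !big_ord_recr /= subnn C0 !mulr1.
rewrite (eq_bigr (fun j : 'I_i => B`_j * C`_(i - j))) => [/addrI //|j _].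
by rewrite IHi // (ltn_trans (ltn_ord j)).
Qed.

Definition section d r A : {poly R} := \poly_(i < size A) A`_(d * i + r).

Lemma coef_section d r A i : (0 < d)%N -> (section d r A)`_i = A`_(d * i + r).
Proof.
move=> d_gt0; rewrite coef_poly; case: ltnP => // le_Ai.
rewrite nth_default // (leq_trans le_Ai) //.
by rewrite (leq_trans (leq_pmull i d_gt0)) // leq_addr.
Qed.

Lemma sectionD d r A B : (0 < d)%N ->
  section d r (A + B) = section d r A + section d r B.
Proof. by move=> d_gt0; apply/polyP => i; rewrite coefD !coef_section // coefD. Qed.

(** Series in q^d are scalars for the extraction. By induction on [B]: a factor X^d before
    extraction becomes X after it, and r < d keeps the shifted constant coefficient zero. *)
Lemma section_compM d r A B : (0 < d)%N -> (r < d)%N ->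
  section d r (A * (B \Po 'X^d)) = section d r A * B.
Proof.
move=> d_gt0 lt_rd; elim/poly_ind: B => [|B c IHB].
  by rewrite comp_poly0 !mulr0; apply/polyP => i; rewrite coef_section // !coef0.
rewrite comp_polyD comp_polyC comp_polyM comp_polyX !mulrDr sectionD //.
congr (_ + _); last by apply/polyP => i; rewrite !(coef_section, coefMC).
rewrite !mulrA -IHB; apply/polyP => i.
rewrite coef_section // coefMXn coefMX; case: i => [|i].
  by rewrite muln0 add0n lt_rd.
rewrite coef_section // ltnNge mulnS -addnA leq_addr /=.
by congr (_`_ _); lia.
Qed.

Lemma eqm_section m n d r A B : (0 < d)%N -> (d * n + r < m)%N ->
  eqm m A B -> eqm n.+1 (section d r A) (section d r B).
Proof.
move=> d_gt0 lt_m AB i lt_in; rewrite !coef_section //; apply: AB.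
by apply: leq_ltn_trans lt_m; rewrite leq_add2r leq_mul2l -ltnS lt_in orbT.
Qed.

End TruncatedEquality.

(** * The series psi and the involution on representations *)

Definition is_tri (m : nat) : bool := [exists s : 'I_m.+1, tri s == m].

Lemma is_triP m : reflect (exists s, tri s = m) (is_tri m).
Proof.
apply: (iffP existsP) => [[s /eqP sm] | [s sm]]; first by exists s.
have lt_sm : (s < m.+1)%N by rewrite ltnS -sm leq_tri.
by exists (Ordinal lt_sm); apply/eqP.
Qed.

(** Completing the square: 8 T_s + 1 = (2s+1)^2, and x must be odd. *)
Lemma is_tri_square m : is_tri m <-> exists x, (x * x = 8 * m + 1)%N.
Proof.
split=> [/is_triP[s <-] | [x xx]].
  by exists (2 * s).+1; have := triE s; nia.
apply/is_triP; exists (x %/ 2)%N; have := triE (x %/ 2).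
have : (x = 2 * (x %/ 2) + 1)%N.
  have : odd (x * x) by rewrite xx; lia.
  by rewrite oddM andbb; lia.
by nia.
Qed.

(** Since s <= T_s, keeping s < n is exact in all degrees below n. *)
Definition psi (R : nzRingType) (n : nat) : {poly R} :=
  \sum_(0 <= s < n) 'X^(tri s).

Lemma coef_psi (R : nzRingType) n i : (i < n)%N -> (psi R n)`_i = (is_tri i)%:R.
Proof.
move=> lt_in; rewrite /psi coef_sum big_mkord.
have [/is_triP[s si] | nti] := boolP (is_tri i).
  have lt_sn : (s < n)%N by apply: leq_ltn_trans lt_in; rewrite -si leq_tri.
  rewrite (bigD1 (Ordinal lt_sn)) //= coefXn si eqxx big1 ?addr0 // => j.
  rewrite -val_eqE /= coefXn -si (inj_eq tri_inj) eq_sym.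
  by move/negPf->.
rewrite big1 // => s _; rewrite coefXn; case: eqP => // si.
by case/is_triP: nti; exists s.
Qed.

(* With x = 2a+1 and y = 2b+1, this is (x, y) |-> (|x + 3ey|/2, |x - ey|/2), where
   the sign e is the one for which these are odd: multiplication by a cube root
   of unity in the norm form x^2 + 3y^2. *)
Definition swap_rep (a b : nat) : nat * nat :=
  if odd (a + b) then ((a + 3 * b + 1) %/ 2, ((a - b) + (b - a) - 1) %/ 2)%N
  else ((if (a <= 3 * b)%N then (3 * b - a) %/ 2 else (a - 3 * b - 2) %/ 2),
        (a + b) %/ 2)%N.

(** Invariance of the norm, as x^2 + 3y^2 = 8(T_a + 3 T_b) + 4. *)
Lemma swap_rep_tri a b :
  (tri (swap_rep a b).1 + 3 * tri (swap_rep a b).2 = tri a + 3 * tri b)%N.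
Proof.
rewrite /swap_rep; case: ifP => /= odd_ab.
  set a' := (_ %/ 2)%N; set b' := (_ %/ 2)%N.
  have := (triE a, triE b, triE a', triE b').
  have : (b <= a /\ a = b + 2 * b' + 1 /\ a' = 2 * b + b' + 1 \/
          a <= b /\ b = a + 2 * b' + 1 /\ a' = 2 * a + 3 * b' + 2)%N by lia.
  by clearbody a' b'; case=> [] [_ [-> ->]] [[[]]]; lia.
case: leqP => [le_a|gt_a]; set a' := (_ %/ 2)%N; set b' := (_ %/ 2)%N;
  have := (triE a, triE b, triE a', triE b').
  have [ea eb'] : (a = 3 * b - 2 * a' /\ b' = 2 * b - a')%N by lia.
  have [le1 le2] : (2 * a' <= 3 * b)%N /\ (a' <= 2 * b)%N by lia.
  clearbody a' b'; case=> [[[]]]; nia.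
have [eb ea] : (a = 3 * b + 2 + 2 * a' /\ b' = 2 * b + 1 + a')%N by lia.
by clearbody a' b'; rewrite ea eb => [[[[]]]]; lia.
Qed.

Lemma swap_repK a b :
  swap_rep (swap_rep a b).1 (swap_rep a b).2 = (a, b).
Proof.
case E: (swap_rep a b) => [a' b'] /=; move: E; rewrite /swap_rep.
case: ifP => odd_ab; [|case: ifP => le_ab]; case=> ea eb;
  (case: ifP => odd_ab'; [|case: ifP => le_ab']); congr (_, _); lia.
Qed.

(** The fixed points are x = y (for e = -1) and x = 3y (for e = 1). *)
Lemma swap_rep_fixed a b :
  (swap_rep a b == (a, b)) = (a == b) || (a == 3 * b + 1)%N.
Proof.
rewrite /swap_rep; case: ifP => odd_ab; [|case: ifP => le_ab];
  by rewrite xpair_eqE; apply/idP/idP; lia.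
Qed.

(** * The product psi(q) psi(q^3) modulo 2 *)

Lemma coef_psi_comp (R : comNzRingType) n d i : (0 < d)%N ->
  (psi R n \Po 'X^d)`_i = \sum_(s < n) (d * tri s == i)%:R.
Proof.
move=> d_gt0; rewrite coef_comp_poly_Xn // /psi coef_sum big_mkord.
case: ifP => [/dvdnP[k ->]|ndvd].
  by apply: eq_bigr => s _; rewrite mulnK // coefXn eq_sym [(k * d)%N]mulnC eqn_pmul2l.
by rewrite big1 // => s _; case: eqP => // ei; rewrite -ei dvdn_mulr in ndvd.
Qed.

(** The coefficient of q^m counts the pairs with T_a + 3 T_b = m. Modulo 2 only the fixed points of
    the involution remain: a = b gives 4 T_b, and a = 3b+1 gives 12 T_b + 1. *)
Lemma psi_mul_psi3 (R : comNzRingType) n : (forall x : R, x + x = 0) ->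
  eqm n (psi R n * (psi R n \Po 'X^3))
        ((psi R n \Po 'X^4) + 'X * (psi R n \Po 'X^12)).
Proof.
move=> R2 m lt_mn; pose P (p : 'I_n * 'I_n) := (tri p.1 + 3 * tri p.2 == m)%N.
pose f (p : 'I_n * 'I_n) :=
  let r := swap_rep p.1 p.2 in (insubd p.1 r.1, insubd p.2 r.2).
(* The defaults of [insubd] are never reached on [P]: both new indices are at most their triangular
   numbers, hence at most m < n. *)
have fE p : P p -> ((f p).1 = (swap_rep p.1 p.2).1 :> nat) *
                   ((f p).2 = (swap_rep p.1 p.2).2 :> nat).
  move=> /eqP Pp; have := swap_rep_tri p.1 p.2; rewrite Pp => er.
  have := (leq_tri (swap_rep p.1 p.2).1, leq_tri (swap_rep p.1 p.2).2).
  by case=> le1 le2; rewrite !insubdK // unfold_in; lia.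
clearbody f; have pairE (Q : pred ('I_n * 'I_n)) :
    \sum_(p | Q p) 1 = \sum_a \sum_b (Q (a, b))%:R :> R.
  by rewrite pair_bigA /= big_mkcond; apply: eq_bigr => -[a b] _ /=; case: (Q _).
transitivity (\sum_(p | P p) 1 : R).
  rewrite {1}/psi big_mkord big_distrl /= coef_sum.
  rewrite pairE.
  apply: eq_bigr => a _; rewrite coefXnM coef_psi_comp //.
  case: ltnP => lt_ma.
    by rewrite big1 // => b _; rewrite /P /=; case: eqP => //; lia.
  apply: eq_bigr => b _; rewrite /P /=; congr (_%:R); congr nat_of_bool.
  by apply/eqP/eqP; lia.
rewrite (@sum_involution_pchar2 _ _ P f) //; first last.
- move=> p Pp; have Pfp : P (f p).
    by rewrite /P !fE // swap_rep_tri.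
  rewrite [RHS]surjective_pairing [LHS]surjective_pairing.
  by congr (_, _); apply: val_inj; rewrite /= !fE // swap_repK.
- by move=> p Pp; rewrite /P !fE // swap_rep_tri.
transitivity (\sum_b \sum_a ((P (a, b) && (a == b))%:R
                 + (P (a, b) && (a == 3 * b + 1 :> nat)%N)%:R) : R).
  rewrite pairE exchange_big; apply: eq_bigr => b _; apply: eq_bigr => a _ /=.
  have [Pab | _] := boolP (P (a, b)); last by rewrite addr0.
  have -> : (f (a, b) == (a, b)) = (swap_rep a b == (a : nat, b : nat)).
    rewrite [swap_rep a b]surjective_pairing [f _]surjective_pairing.
    by rewrite !xpair_eqE -!val_eqE /= !fE.
  rewrite swap_rep_fixed /= -val_eqE /=.
  have [/= eab | _] := eqVneq (a : nat) (b : nat); last by rewrite add0r; case: eqP.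
  by rewrite (_ : _ == _ = false) ?addr0 //; apply/eqP; lia.
rewrite coefD coefXM !coef_psi_comp //.
transitivity
  (\sum_(b < n) ((4 * tri b == m)%N%:R + (12 * tri b + 1 == m)%N%:R) : R).
  apply: eq_bigr => b _; rewrite big_split /=; congr (_ + _).
    rewrite (bigD1 b) //= eqxx andbT big1 => [|a /negPf ->]; last by rewrite andbF.
    by rewrite addr0 /P /=; congr (_%:R); congr nat_of_bool; apply/eqP/eqP; lia.
  have T3 : (tri (3 * b + 1) = 9 * tri b + 1)%N.
    by have := triE b; have := triE (3 * b + 1); lia.
  case: (ltnP (3 * b + 1) n) => [lt_n | le_n].
    rewrite (bigD1 (Ordinal lt_n)) //= eqxx andbT big1 => [|a].
      rewrite addr0 /P /= T3; congr (_%:R); congr nat_of_bool.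
      by apply/eqP/eqP; lia.
    by rewrite -val_eqE /= => /negPf ->; rewrite andbF.
  (* Here 3b+1 is out of range, but then 12 T_b + 1 >= T_(3b+1) >= n > m, so both sides vanish. *)
  have -> : (12 * tri b + 1 == m)%N = false.
    by apply/eqP; have := leq_tri (3 * b + 1); lia.
  rewrite big1 // => a _; rewrite (_ : _ == _ = false) ?andbF //.
  by apply/eqP; have := ltn_ord a; lia.
rewrite big_split /=; congr (_ + _).
case: m {lt_mn P f fE pairE} => [|m] /=.
  by rewrite big1 // => b _; rewrite addn1.
by apply: eq_bigr => b _; rewrite addn1 eqSS.
Qed.

(** * Frobenius on polynomials over F_2 *)

Lemma F2_char2 (x : {poly 'F_2}) : x + x = 0.
Proof. by apply: addrr_pchar2; rewrite pchar_poly pchar_Fp. Qed.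

Lemma F2_sqr (c : 'F_2) : c ^+ 2 = c.
Proof. by case: c => [[|[|]]] // lt_c; apply: val_inj. Qed.

(** Squaring is additive in characteristic 2 and fixes the coefficients in F_2, so it only doubles
    exponents. *)
Lemma polyF2_sqr (A : {poly 'F_2}) : A ^+ 2 = A \Po 'X^2.
Proof.
elim/poly_ind: A => [|A c IHA]; first by rewrite comp_poly0 expr0n.
rewrite comp_polyD comp_polyM comp_polyX comp_polyC -IHA.
rewrite sqrrD mulr2n F2_char2 addr0 exprMn.
by rewrite -[X in _ + X]rmorphXn F2_sqr.
Qed.

Lemma polyF2_exp2n k (A : {poly 'F_2}) : A ^+ (2 ^ k) = A \Po 'X^(2 ^ k).
Proof.
elim: k => [|k IHk]; first by rewrite comp_polyXr.
by rewrite expnSr exprM IHk polyF2_sqr -comp_polyA comp_Xn_poly -exprM mulnC.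
Qed.

(** * The product (q;q), its inverse, and Gauss's product for psi *)

Section QPochhammer.
Variable R : comNzRingType.

Definition qpoch n : {poly R} := \prod_(1 <= j < n.+1) (1 - 'X^j).

Definition qpoch_inv n : {poly R} :=
  \prod_(1 <= j < n.+1) \sum_(0 <= k < n.+1) 'X^(j * k).

Lemma comp_Xn (a j : nat) : 'X^j \Po 'X^a = 'X^(a * j) :> {poly R}.
Proof. by rewrite comp_Xn_poly -exprM. Qed.

Lemma map_qpoch_trunc (f : {rmorphism int -> R}) a n :
  map_poly f (qpoch_trunc a n) = qpoch n \Po 'X^a.
Proof.
rewrite /qpoch_trunc /qpoch !rmorph_prod; apply: eq_bigr => j _.
by rewrite !rmorphB !rmorph1 /= map_polyXn comp_Xn.
Qed.

Lemma map_qpoch_inv_trunc (f : {rmorphism int -> R}) a n :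
  map_poly f (qpoch_inv_trunc a n) = qpoch_inv n \Po 'X^a.
Proof.
rewrite /qpoch_inv_trunc /qpoch_inv !rmorph_prod; apply: eq_bigr => j _.
rewrite !rmorph_sum; apply: eq_bigr => k _.
by rewrite /= map_polyXn comp_Xn mulnA.
Qed.

Lemma eqm_1subX n j : (n < j)%N -> eqm n.+1 (1 - 'X^j) (1 : {poly R}).
Proof.
move=> lt_nj i le_in; rewrite coefB coefXn; case: eqP => [ij | _]; last exact: subr0.
by move: lt_nj; rewrite -ij ltnNge -ltnS le_in.
Qed.

(** Each factor times its truncated geometric series is 1 - X^(j(n+1)), which is 1 up to degree
    n. *)
Lemma qpoch_mul_inv n : eqm n.+1 (qpoch n * qpoch_inv n) 1.
Proof.
rewrite /qpoch /qpoch_inv -big_split /= big_add1 /=.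
apply: eqm_prod1 => j.
have -> : (1 - 'X^(j.+1)) * (\sum_(0 <= k < n.+1) 'X^(j.+1 * k))
    = 1 - 'X^(j.+1 * n.+1) :> {poly R}.
  rewrite exprM -[RHS]opprB subrX1 -mulNr opprB big_mkord; congr (_ * _).
  by apply: eq_bigr => k _; rewrite exprM.
by apply: eqm_1subX; rewrite leq_pmull.
Qed.

Lemma coef0_qpoch n : (qpoch n)`_0 = 1.
Proof.
rewrite -horner_coef0 /qpoch horner_prod big_nat big1 // => -[//|j] _.
by rewrite !hornerE expr0n subr0.
Qed.

Lemma qpoch_eqm m n : (m <= n)%N -> eqm m.+1 (qpoch n) (qpoch m).
Proof.
move=> /subnKC <-; elim: (n - m)%N => [|k IHk]; first by rewrite addn0.
rewrite addnS {1}/qpoch big_nat_recr //= -[X in eqm _ _ X]mulr1.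
by apply: eqmM => //; apply: eqm_1subX; lia.
Qed.

Lemma eqm_psi m n k : (m <= n)%N -> (m <= k)%N -> eqm m (psi R n) (psi R k).
Proof.
by move=> le_mn le_mk i lt_im; rewrite !coef_psi // (leq_trans lt_im).
Qed.

(* Gauss: psi(q) = (q^2; q^2)^2 / (q; q), as the limit of [shanks_identity],
   where only the term s = 0 is not divisible by q^(2n+1). *)
Lemma gauss_psi n :
  eqm n.+1 (qpoch n * psi R n.+1) ((qpoch n \Po 'X^2) ^+ 2).
Proof.
(* The truncation [psi R (2 * n)] used below is exact up to degree n only if n+1 <= 2n. *)
have [-> | n_gt0] := posnP n.
  move=> [|//] _; rewrite /qpoch big_geq // mul1r comp_polyC expr1n coef_psi //.
  by rewrite coef1 /=; case: is_triP => // -[]; exists 0%N.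
have ev : \prod_(0 <= j < n) (1 - 'X^(2 * j.+1)) = qpoch n \Po 'X^2 :> {poly R}.
  rewrite /qpoch big_add1 /= rmorph_prod; apply: eq_bigr => j _.
  by rewrite rmorphB rmorph1 /= comp_Xn.
have odd_ev : (\prod_(0 <= j < n) (1 - 'X^((2 * j).+1))) * (qpoch n \Po 'X^2)
     = qpoch (2 * n).
  rewrite -ev /qpoch big_add1 /=; elim: (n) => [|k IHk].
    by rewrite !big_geq ?mulr1.
  rewrite (_ : 2 * k.+1 = (2 * k).+2)%N; last by lia.
  rewrite !big_nat_recr //= -IHk.
  rewrite (_ : 2 * k.+1 = (2 * k).+2)%N; last by lia.
  by rewrite -!mulrA; congr (_ * _); rewrite mulrCA.
have shanks := @shanks_identity {poly R} 'X n.
rewrite [LHS]big_ltn // mul0n expr0 mulr1 ev in shanks.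
rewrite [X in X * _ + _]big_geq // mul1r -/(psi R (2 * n)) in shanks.
move: shanks; set tl := (\sum_(1 <= i < n) _) => shanks.
have tl0 : eqm n.+1 tl 0.
  move=> i le_in; rewrite coef0 /tl coef_sum big_nat big1 // => s /andP[s_gt0 _].
  by rewrite coefMXn ifT //; nia.
have le_n2n : (n <= 2 * n)%N by lia.
apply: (@eqm_trans _ _ _ (qpoch (2 * n) * psi R (2 * n))).
  by apply: eqmM; [exact/eqm_sym/qpoch_eqm | apply: eqm_psi; lia].
(* Splitting (q;q)_2n into odd and even factors, Shanks' identity turns the odd part times psi into
   the even part plus [tl]. *)
rewrite -odd_ev mulrAC -shanks mulrDl -expr2 -[X in eqm _ _ X]addr0.
apply: eqmD => // i le_in; have := eqmMr (qpoch n \Po 'X^2) tl0 le_in.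
by rewrite mul0r.
Qed.

End QPochhammer.

(* Jacobi's identity for (q; q)^3 modulo 2. *)
Lemma psi_eqm_cube n : eqm n.+1 (psi 'F_2 n.+1) (qpoch 'F_2 n ^+ 3).
Proof.
(* After multiplication by (q;q), Gauss's product gives (q^2;q^2)^2, which is (q;q)^4 by
   Frobenius. *)
apply: (@eqmM2r _ _ _ _ (qpoch 'F_2 n)); first exact: coef0_qpoch.
by rewrite mulrC -exprSr; have := @gauss_psi 'F_2 n; rewrite -polyF2_sqr -exprM.
Qed.

(** Modulo 2, (q^2;q^2) = (q;q)^2 and (q^6;q^6) = (q^3;q^3)^2, so F reduces to (q;q)^3 /
    (q^3;q^3)^9, that is psi(q) / psi(q^3)^3. *)
Lemma F6_trunc_psi n : let F := map_poly (intr : int -> 'F_2) (F6_trunc n) in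
  eqm n.+1 (F * (psi 'F_2 n.+1 \Po 'X^3) ^+ 3) (psi 'F_2 n.+1).
Proof.
move=> F.
pose P := qpoch 'F_2 n; pose I := qpoch_inv 'F_2 n.
pose P3 := P \Po 'X^3; pose I6 := I \Po 'X^6.
have FE : F = (P ^+ 2 * P3 ^+ 3 * I * I6 ^+ 3) ^+ 3.
  rewrite /F /F6_trunc rmorphXn 3!rmorphM 2!rmorphXn /=.
  by rewrite !map_qpoch_trunc !map_qpoch_inv_trunc comp_polyXr -polyF2_sqr.
have psi3 : eqm n.+1 (psi 'F_2 n.+1 \Po 'X^3) (P3 ^+ 3).
  by rewrite /P3 -rmorphXn; apply: eqm_comp => //; exact: psi_eqm_cube.
have PI : eqm n.+1 (P * I) 1 by exact: qpoch_mul_inv.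
have PI6 : eqm n.+1 (P3 ^+ 2 * I6) 1.
  have -> : P3 ^+ 2 = P \Po 'X^6.
    by rewrite polyF2_sqr /P3 -comp_polyA comp_Xn.
  rewrite /I6 -rmorphM -[1](comp_polyC 1 'X^6); exact: eqm_comp.
apply: (eqm_trans (eqmMl F (eqmX 3 psi3))).
apply: eqm_trans _ (eqm_sym (@psi_eqm_cube n)).
have -> : F * (P3 ^+ 3) ^+ 3 = (P * I) ^+ 3 * (P3 ^+ 2 * I6) ^+ 9 * P ^+ 3.
  by rewrite FE; ring.
have := eqmMr (P ^+ 3) (eqmM (eqmX 3 PI) (eqmX 9 PI6)).
by rewrite !expr1n !mul1r.
Qed.

(** * Extraction modulo 3 and modulo 8 *)

(** T_(3r) and T_(3r+2) are divisible by 3, while T_(3r+1) = 9 T_r + 1. *)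
Lemma is_tri_mod3 i : is_tri (3 * i + 1) = (3 %| i)%N && is_tri (i %/ 3).
Proof.
apply/idP/andP => [/is_triP[s si] | [/dvdnP[k ->] /is_triP[s si]]].
  have Ts := triE s; pose r := (s %/ 3)%N; have Tr := triE r.
  have : (s = 3 * r \/ s = 3 * r + 1 \/ s = 3 * r + 2)%N by lia.
  case=> [es | [es | es]]; rewrite si es in Ts.
  - by exfalso; nia.
  - have -> : i = (3 * tri r)%N by lia.
    by rewrite dvdn_mulr // mulKn //; split=> //; apply/is_triP; exists r.
  - by exfalso; nia.
apply/is_triP; exists (3 * s + 1)%N; rewrite mulnK // in si.
by have := triE s; have := triE (3 * s + 1); lia.
Qed.

Lemma section_psi n m : (3 * m + 1 < n)%N ->
  eqm m.+1 (section 3 1 (psi 'F_2 n)) (psi 'F_2 n \Po 'X^3).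
Proof.
move=> lt_n i le_im; rewrite coef_section // coef_comp_poly_Xn //.
rewrite coef_psi; last by lia.
rewrite is_tri_mod3; case: ifP => //= _; rewrite coef_psi //.
by have := leq_div i 3; lia.
Qed.

Lemma F6_coef_mod2 l :
  (F6_coef (24 * l + 4))%:~R = (is_tri l)%:R :> 'F_2.
Proof.
set n := (24 * l + 4)%N; pose F := map_poly (intr : int -> 'F_2) (F6_trunc n).
(* The residue is 1, not 0, because F is shifted by one degree from j_6; thus [W] is the series of
   the c(3m). *)
pose y := psi 'F_2 n.+1; pose z := y \Po 'X^3; pose W := section 3 1 F.
have z_exp k : z ^+ (2 ^ k) = z \Po 'X^(2 ^ k) by exact: polyF2_exp2n.
have y_exp k : y ^+ (2 ^ k) = y \Po 'X^(2 ^ k) by exact: polyF2_exp2n.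
have yz : eqm (8 * l + 2) (y * z) (y ^+ 4 + 'X * z ^+ 4).
  rewrite (z_exp 2%N) (y_exp 2%N) /z -comp_polyA comp_Xn.
  apply: (@eqm_leq _ _ n.+1); first by lia.
  by apply: psi_mul_psi3; apply: addrr_pchar2; rewrite pchar_Fp.
have Wy : eqm (8 * l + 2) (W * y ^+ 3) z.
  have lt_n : (3 * (8 * l + 1) + 1 < n.+1)%N by lia.
  rewrite (_ : 8 * l + 2 = (8 * l + 1).+1)%N; last by lia.
  apply: eqm_trans (section_psi lt_n).
  have := eqm_section (isT : (0 < 3)%N) lt_n (@F6_trunc_psi n).
  by rewrite -rmorphXn section_compM.
have pow4D (a b : {poly 'F_2}) : (a + b) ^+ 4 = a ^+ 4 + b ^+ 4.
  have pow4 (c : {poly 'F_2}) : c ^+ 4 = c \Po 'X^4 := polyF2_exp2n 2 c.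
  by rewrite (pow4 (a + b)) comp_polyD -!pow4.
(* Multiplying by y^5 completes y^3 to y^8, a series in q^8 that the extraction modulo 8 lets
   through. *)
have Wy8 : eqm (8 * l + 2) (W * y ^+ 8) (y ^+ 8 + 'X * y ^+ 16 + 'X^5 * z ^+ 16).
  have -> : W * y ^+ 8 = W * y ^+ 3 * y ^+ 5 by ring.
  apply: (eqm_trans (eqmMr (y ^+ 5) Wy)).
  have -> : z * y ^+ 5 = y * z * y ^+ 4 by ring.
  apply: (eqm_trans (eqmMr (y ^+ 4) yz)).
  have -> : (y ^+ 4 + 'X * z ^+ 4) * y ^+ 4 = y ^+ 8 + 'X * (y * z) ^+ 4 by ring.
  rewrite -addrA; apply: eqmD => //.
  apply: (eqm_trans (eqmMl 'X (eqmX 4 yz))).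
  rewrite pow4D; have -> // : 'X * ((y ^+ 4) ^+ 4 + ('X * z ^+ 4) ^+ 4) =
     'X * y ^+ 16 + 'X^5 * z ^+ 16 by ring.
have lt8 : (8 * l + 1 < 8 * l + 2)%N by lia.
(* On exponents 1 mod 8, y^8 and q^5 z^16 contribute nothing and q y^16 gives y^2. Hence the section
   of [W] times y is y^2, and y cancels. *)
have := eqm_section (isT : (0 < 8)%N) lt8 Wy8.
have pow8 (c : {poly 'F_2}) : c ^+ 8 = c \Po 'X^8 := polyF2_exp2n 3 c.
rewrite !sectionD // (exprM y 2 8) (exprM z 2 8).
rewrite (pow8 y) (pow8 (y ^+ 2)) (pow8 (z ^+ 2)).
rewrite !section_compM // -[y \Po _]mul1r section_compM //.
have sec1 : section 8 1 (1 : {poly 'F_2}) = 0.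
  by apply/polyP => i; rewrite coef_section // coef1 coef0 addn1.
have secX : section 8 1 ('X : {poly 'F_2}) = 1.
  apply/polyP => i; rewrite coef_section // coefX coef1.
  by congr (_%:R); congr nat_of_bool; apply/eqP/eqP; lia.
have secX5 : section 8 1 ('X^5 : {poly 'F_2}) = 0.
  by apply/polyP => i; rewrite coef_section // coefXn coef0; case: eqP => //; lia.
rewrite sec1 secX secX5 !mul0r add0r addr0 mul1r expr2.
have y0 : y`_0 = 1.
  by rewrite /y coef_psi //; case: is_triP => // -[]; exists 0%N.
move/(eqmM2r y0)/(_ l (leqnn _)).
rewrite !coef_section // coef_map /= -/(F6_coef _) coef_psi; last by lia.
by rewrite /n (_ : (3 * (8 * l + 1) + 1 = 24 * l + 4)%N) //; lia.
Qed.

(** * Parity of J_6 and comparison of the two indices *)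

Lemma J6_mod2 l : ((J6 (24 * l + 3))%:~R : 'F_2) = (is_tri l)%:R.
Proof.
by rewrite /J6 addn_eq0 andbF subr0 -addnS F6_coef_mod2.
Qed.

(** A factor p^2 does not affect being a square: if x^2 = p^2 (8b+1), then p divides x. *)
Lemma is_tri_mul_sqr p a b : prime p ->
  (8 * a + 1 = p ^ 2 * (8 * b + 1))%N -> is_tri a = is_tri b.
Proof.
move=> p_pr eab; have p_gt0 := prime_gt0 p_pr.
apply/idP/idP => /is_tri_square[x xx]; apply/is_tri_square; last first.
  by exists (p * x)%N; rewrite eab -xx; lia.
have /dvdnP[y ey] : (p %| x)%N.
  have : (p %| x ^ 2)%N by rewrite -mulnn xx eab expnS -mulnA dvdn_mulr.
  by rewrite Euclid_dvdX // andbT.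
exists y; apply/eqP; rewrite -(@eqn_pmul2l (p ^ 2)) ?expn_gt0 ?p_gt0 //.
by apply/eqP; rewrite -eab -xx ey; lia.
Qed.

Local Close Scope ring_scope.

Theorem theorem3p6 (k n i p delta : nat) :
  (0 < k)%N -> i \in [:: 3%N; 5%N; 7%N] -> prime p -> p %% 8 = i ->
  p %| 8 * delta + i ->
  let N1 := (3 * p * (8 * p ^ k * n + 8 * delta + i))%N in
  let N2 := (24 * (p ^ k.-1 * n + (8 * delta + i - p) %/ (8 * p)) + 3)%N in
  (J6 N1 = J6 N2 %[mod 2])%Z.
Proof.
move=> k_gt0 i357 p_pr pi /dvdnP[c ec] N1 N2.
have p_gt0 := prime_gt0 p_pr.
have i_lt8 : (i < 8)%N by rewrite -pi ltn_mod.
have pp8 : (p * p %% 8 = 1)%N.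
  by rewrite -modnMm pi; move: i357; rewrite !inE => /or3P[] /eqP ->.
have [d ed] : exists d, c = (8 * d + 1)%N.
  suff c8 : (c %% 8 = 1)%N by exists (c %/ 8)%N; rewrite {1}(divn_eq c 8) c8 mulnC.
  (* With 8 delta + i = cp and p^2 = 1 mod 8: c = (cp)p = ip = p^2 = 1 mod 8. *)
  have -> : c = c * (p * p) %[mod 8] by rewrite -modnMmr pp8 muln1.
  rewrite mulnA -ec mulnC -modnMmr [(8 * delta)%N]mulnC modnMDl.
  by rewrite -pi modn_mod modnMmr.
have delta_div : ((8 * delta + i - p) %/ (8 * p) = d)%N.
  by rewrite ec ed mulnDl mul1n addnK mulnAC mulKn // muln_gt0.
have [a ea] : exists a, (N1 = 24 * a + 3 /\ 8 * a + 1 =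
    p ^ 2 * (8 * (p ^ k.-1 * n + d) + 1))%N.
  (* This is the solution of 8a + 1 = p^2 (8b + 1), namely a = p^2 b + (p^2 - 1)/8. *)
  exists (p * p * (p ^ k.-1 * n + d) + (p * p) %/ 8)%N.
  have e8 : (p * p = 8 * ((p * p) %/ 8) + 1)%N by lia.
  split; last by rewrite -mulnn; lia.
  rewrite /N1 -addnA ec ed -(prednK k_gt0) expnS [k.-1.+1.-1]/=.
  by lia.
apply/eqP; rewrite eqz_mod_dvd (dvdz_pcharf (pchar_Fp (isT : prime 2))).
case: ea => -> ea; rewrite /N2 delta_div rmorphB /= !J6_mod2.
by rewrite (is_tri_mul_sqr p_pr ea) subrr.
Qed.
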